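(* For every integer $k\ge3$ there is $\epsilon_1>0$ such that for every $0<\epsilon\le\epsilon_1$ there is $\gamma_1>0$ such that for every $0<\gamma\le\gamma_1$ there is $n_0$ such that the following holds for all $n\ge n_0$. Suppose $H$ is a $k$-partite $k$-graph with parts $V_1,\dots,V_k$, each of size $n$, and let $a_i:=\delta_{[k]\setminus\{i\}}(H)$ for $i\in[k]$. Suppose that $(1-\epsilon)n\ge a_1\ge a_2\ge\cdots\ge a_k$, $a_2\ge\epsilon n$, and $\sum_{i=1}^k a_i\ge(1-\gamma/5)n$. Then one of the following holds: (i) $H$ contains a matching of size at least $n-1$; (ii) $H$ is $\gamma$-S-extremal; (iii) $H$ is $2k^2\epsilon$-D-extremal.
   Context: $[k]=\{1,\dots,k\}$. A $k$-graph consists of a vertex set $V(H)$ and an edge set $E(H)$ of $k$-element subsets of $V(H)$. It is $k$-partite with parts $V_1,\dots,V_k$ if these sets partition $V(H)$ and every edge contains exactly one vertex from each $V_i$. A matching is a collection of pairwise disjoint edges; its size is the number of edges. A set is independent if it contains no edge. A set $S\subseteq V(H)$ is crossing if $|S\cap V_i|\le1$ for all $i$. $\delta_{[k]\setminus\{i\}}(H)$ is the minimum, over all $(k-1)$-sets $S$ containing exactly one vertex from each $V_j$, $j\ne i$, of the number $\deg_H(S)$ of vertices $v$ with $S\cup\{v\}\in E(H)$. Let $H$ be a $k$-partite $k$-graph with each part of size $n$, let $a_i:=\delta_{[k]\setminus\{i\}}(H)$, and let $\theta>0$. $H$ is $\theta$-S-extremal if $\sum_{i=1}^k a_i\le(1+\theta)n$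 and $V(H)$ contains an independent set $C$ such that $|C\cap V_i|\ge n-a_i-\theta n$ for each $i\in[k]$. $H$ is $\theta$-D-extremal if there is a partition $A\cup B$ of $V(H)$ such that, writing $A_i:=A\cap V_i$, (i) $(1/2-\theta)n\le a_1,a_2,|A_1|,|A_2|\le(1/2+\theta)n$ and $a_i\le\theta n$ for $i\ge3$; and (ii) $|E_{even}(A,B)\setminus E(H)|\le\theta n^k$ or $|E_{odd}(A,B)\setminus E(H)|\le\theta n^k$. Here $E_{even}(A,B)$ (respectively $E_{odd}(A,B)$) is the family of all crossing $k$-subsets of $V(H)$ that intersect $A$ in an even (respectively odd) number of vertices. *)

(* Defs.v *)
From mathcomp Require Import all_boot all_order all_algebra.
From mathcomp Require Import reals.

Set Implicit Arguments.
Unset Strict Implicit.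
Unset Printing Implicit Defensive.

Import Order.TTheory GRing.Theory Num.Theory.

(** The vertex set of a hypergraph is a whole finite type [T], and its edge set
    is [E : {set {set T}}].  The parts V_1, ..., V_k are given by
    [V : 'I_k -> {set T}], so V_(i+1) of the text is [V i]. *)

Definition kgraph (k : nat) (T : finType) (E : {set {set T}}) : Prop :=
  forall e : {set T}, e \in E -> #|e| = k.

Definition kpartite (k : nat) (T : finType) (V : 'I_k -> {set T})
    (E : {set {set T}}) : Prop :=
  [/\ \bigcup_(i < k) V i = [set: T],
      forall i j : 'I_k, i != j -> [disjoint V i & V j]
    & forall e : {set T}, e \in E -> forall i : 'I_k, #|e :&: V i| = 1].

Definition matching (T : finType) (E M : {set {set T}}) : Prop :=
  M \subset E /\ trivIset M.

Definition independent (T : finType) (E : {set {set T}}) (C : {set T}) : Prop :=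
  forall e : {set T}, e \in E -> ~~ (e \subset C).

Definition crossing (k : nat) (T : finType) (V : 'I_k -> {set T})
    (S : {set T}) : bool :=
  [forall i : 'I_k, #|S :&: V i| <= 1].

Definition deg (T : finType) (E : {set {set T}}) (S : {set T}) : nat :=
  #|[set v : T | (v |: S) \in E]|.

Definition transversals_off (k : nat) (T : finType) (V : 'I_k -> {set T})
    (i : 'I_k) : {set {set T}} :=
  [set S : {set T} | (#|S| == k.-1)
                     && [forall j : 'I_k, (j != i) ==> (#|S :&: V j| == 1)]].

(** Degrees never exceed [#|T|], so the default value [#|T|] does not affect the
    minimum as soon as [transversals_off V i] is nonempty, i.e. as soon as the
    parts other than [V i] are nonempty. *)
Definition min_codeg (k : nat) (T : finType) (V : 'I_k -> {set T})
    (E : {set {set T}}) (i : 'I_k) : nat :=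
  \big[minn/#|T|]_(S in transversals_off V i) deg E S.

Definition E_even (k : nat) (T : finType) (V : 'I_k -> {set T})
    (A : {set T}) : {set {set T}} :=
  [set S : {set T} | [&& #|S| == k, crossing V S & ~~ odd #|S :&: A|]].

Definition E_odd (k : nat) (T : finType) (V : 'I_k -> {set T})
    (A : {set T}) : {set {set T}} :=
  [set S : {set T} | [&& #|S| == k, crossing V S & odd #|S :&: A|]].

Local Open Scope ring_scope.

(** In the next two definitions [n] is the common size of the parts. *)

Definition S_extremal (R : realType) (k : nat) (T : finType)
    (V : 'I_k -> {set T}) (E : {set {set T}}) (n : nat) (theta : R) : Prop :=
  (\sum_(i < k) min_codeg V E i)%N%:R <= (1 + theta) * n%:R
  /\ exists C : {set T}, independent E C /\
       forall i : 'I_k,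
         n%:R - (min_codeg V E i)%:R - theta * n%:R <= #|C :&: V i|%:R.

(** The indices 1, 2 of the text are the [i : 'I_k] with [i < 2]. *)
Definition D_extremal (R : realType) (k : nat) (T : finType)
    (V : 'I_k -> {set T}) (E : {set {set T}}) (n : nat) (theta : R) : Prop :=
  exists A B : {set T},
    [/\ A :|: B = [set: T],
        [disjoint A & B],
        forall i : 'I_k, (i < 2)%N ->
          (2^-1 - theta) * n%:R <= (min_codeg V E i)%:R <= (2^-1 + theta) * n%:R
          /\ (2^-1 - theta) * n%:R <= #|A :&: V i|%:R <= (2^-1 + theta) * n%:R,
        forall i : 'I_k, (2 <= i)%N -> (min_codeg V E i)%:R <= theta * n%:R
      & #|E_even V A :\: E|%:R <= theta * n%:R ^+ k
        \/ #|E_odd V A :\: E|%:R <= theta * n%:R ^+ k].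

(* Main.v *)
Require Import Defs.
From mathcomp Require Import all_boot all_order all_algebra.
From mathcomp Require Import reals.
From mathcomp Require Import zify ring lra.

Set Implicit Arguments.
Unset Strict Implicit.
Unset Printing Implicit Defensive.

Import Order.TTheory GRing.Theory Num.Theory.

(** The matching is built by absorption, with absorbers that are single edges.

    Let f and g be disjoint crossing k-sets outside a matching M.  If some edge
    h of M has its vertex in V_1 completing f minus V_1, and its vertex in V_2
    completing g minus V_2, then h can be replaced by these two completions
    ([swap]).  So h absorbs the pair (f, g), and M grows by one edge.  This
    needs two uncovered vertices in each part, hence the bound n - 1.

    The possible absorbers of (f, g) are the edges joining A, the neighbourhood
    of f in V_1, to B, the neighbourhood of g in V_2.  Here |A| >= a_1 and
    |B| >= a_2.  If there are fewer than eps^3 n^k of them, then a_3 < eps n,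
    since otherwise extending A x B x V_4 x ... x V_k through V_3 gives too many
    edges; and |A| + a_1 and |B| + a_2 are at most about n, since otherwise the
    neighbourhood in V_1 of every crossing (k-1)-set that meets B has a large
    part in A, and symmetrically.  As the a_i sum to almost n, the numbers a_1,
    a_2, |A|, |B| are all about n/2.  On average, the neighbourhood in V_2 of a
    (k-1)-set meeting A then has few vertices in B and fills nearly all of V_2
    outside B, and likewise with the roles exchanged.  So nearly all crossing
    sets with exactly one vertex in the union of A and B are edges: this is the
    D-extremal structure ([few_between_parity]).

    Otherwise every pair has at least eps^3 n^k absorbers.  Taking greedily the
    edge that absorbs the largest share of the pairs not yet served, a constant
    proportion of these pairs is served at each step, so O(log n) disjoint edges
    serve all n^(2k) pairs; repeating this K times, for a constant K, gives a
    matching M0 of size O(log n) that contains K absorbers of every pair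
    ([absorbing_family]).

    Let M be a maximum matching among those containing M0.  If M leaves fewer
    than K vertices of each part uncovered, the absorbers in M0 are used one by
    one until n - 1 edges are reached ([absorb]).  If not, take kt disjoint
    uncovered crossing sets r (i, l), for i in [k] and l < t, with t a large
    constant.  Call an edge h of M outside M0 hit in part i if its vertex in V_i
    completes r (i, l) minus V_i for at least k values of l.  An edge hit in two
    parts could be replaced by two edges, so maximality makes the k families of
    hit edges disjoint, while counting degrees shows that the i-th family has
    nearly a_i members.  Hence the a_i sum to at most about n.  Let C consist of
    the vertices, in each V_i, of the edges hit in a part other than i; there
    are about n - a_i of them.  An edge of H inside C could be added to M, each
    edge of M that it meets being replaced by a completion of some r (i, l)
    through its vertex in the part where it is hit.  So C is independent and H
    is S-extremal ([near_perfect_or_space]).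

    All this takes place for a set P of functions from 'I_k to 'I_n, once the
    vertices of each part are numbered. *)

(** * Counting edges from codegrees *)

Section Tuples.
Variables (k n : nat).
Local Notation tup := {ffun 'I_k -> 'I_n}.
Implicit Types (P M : {set tup}) (f g h e : tup) (i j : 'I_k) (v : 'I_n).

Definition upd f i v : tup := [ffun j => if j == i then v else f j].

Lemma upd_same f i v : upd f i v i = v.
Proof. by rewrite ffunE eqxx. Qed.

Lemma upd_other f i v j : j != i -> upd f i v j = f j.
Proof. by rewrite ffunE => /negPf->. Qed.

Definition nbr P i f : {set 'I_n} := [set v | upd f i v \in P].

(** Resampling one coordinate of a uniform tuple leaves it uniform.  This turns
    a lower bound on codegrees into a lower bound on numbers of edges. *)
Lemma sum_card_upd (Q : pred tup) i :
  \sum_f #|[set v | Q (upd f i v)]| = n * #|[set f | Q f]|.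
Proof.
have -> : n * #|[set f | Q f]| = \sum_f \sum_(v : 'I_n) Q f.
  rewrite -sum1dep_card big_distrr /= big_mkcond /=; apply: eq_bigr => f _.
  by rewrite sum_nat_const card_ord; case: (Q f); rewrite ?muln0.
have -> : \sum_f #|[set v | Q (upd f i v)]| = \sum_f \sum_v Q (upd f i v).
  by apply: eq_bigr => f _; rewrite -sum1dep_card big_mkcond.
rewrite !pair_big /=.
pose s (p : tup * 'I_n) := (upd p.1 i p.2, p.1 i).
have sK : involutive s.
  case=> f v; rewrite /s /= upd_same; congr (_, _).
  apply/ffunP => j; rewrite !ffunE; by case: eqP => // ->.
rewrite (reindex_inj (inv_inj sK)) /=; apply: eq_bigr => -[f v] _ /=.
by case: (sK (f, v)) => ->.
Qed.

Lemma card_cyl (i : 'I_k) (A : {set 'I_n}) :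
  n * #|[set f : tup | f i \in A]| = #|A| * n ^ k.
Proof.
rewrite -(sum_card_upd (fun f => f i \in A) i).
rewrite (eq_bigr (fun=> #|A|)) => [|f _].
  by rewrite sum_nat_const card_ffun !card_ord mulnC.
by apply: eq_card => v; rewrite inE upd_same.
Qed.

Definition between P i j (A B : {set 'I_n}) : {set tup} :=
  [set e in P | (e i \in A) && (e j \in B)].

Lemma betweenC P i j A B : between P i j A B = between P j i B A.
Proof. by apply/setP => e; rewrite !inE [(_ \in A) && _]andbC. Qed.

Section Codegrees.
Variables (P : {set tup}) (a : 'I_k -> nat).
Hypothesis deg_ge : forall i f, a i <= #|nbr P i f|.

(** Choose the coordinates other than [m] freely with those at [i] and [j] in
    [A] and [B], then complete through part [m]. *)
Lemma between_dense3 i j m (A B : {set 'I_n}) :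
  i != j -> i != m -> j != m ->
  a m * (#|A| * #|B|) * n ^ k <= n ^ 3 * #|between P i j A B|.
Proof.
move=> ij im jm.
pose Z := [set f : tup | (f i \in A) && (f j \in B)].
have cZ : n * #|Z| = #|B| * #|[set f : tup | f i \in A]|.
  rewrite -(sum_card_upd (fun f => (f i \in A) && (f j \in B)) j).
  rewrite -sum1dep_card big_distrr /= [RHS]big_mkcond /=.
  apply: eq_bigr => f _; case: ifP => fA; rewrite ?muln1.
    by apply: eq_card => v; rewrite inE upd_same upd_other // fA.
  by apply: eq_card0 => v; rewrite inE upd_other // fA.
have cX : a m * #|Z| <= n * #|between P i j A B|.
  have -> : between P i j A B =
      [set f : tup | [&& f \in P, f i \in A & f j \in B]].
    by apply/setP => f; rewrite !inE.
  rewrite -(sum_card_upd (fun f => [&& f \in P, f i \in A & f j \in B]) m).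
  rewrite -sum1dep_card big_distrr /= big_mkcond /=.
  apply: leq_sum => f _; case: ifP => // /andP[fA fB]; rewrite muln1.
  apply: leq_trans (deg_ge m f) _; apply: subset_leq_card.
  by apply/subsetP => v; rewrite !inE !upd_other // fA fB => ->.
have cA := card_cyl i A.
have -> : a m * (#|A| * #|B|) * n ^ k = n * (n * (a m * #|Z|)).
  rewrite [n * (a m * _)]mulnCA cZ !(mulnCA n) cA !mulnA.
  by rewrite -!mulnA [#|A| * _]mulnCA.
by rewrite [n ^ 3]expnS -mulnA leq_mul // expnS expn1 -mulnA leq_mul.
Qed.

(** Choose the coordinates other than [i] with the [j]-th in [B]: the [a i] or
    more completions overlap [A] in at least [a i + #|A| - n] points. *)
Lemma between_dense2 i j (A B : {set 'I_n}) : i != j ->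
  (a i + #|A|) * #|B| * n ^ k
    <= n ^ 2 * #|between P i j A B| + n * #|B| * n ^ k.
Proof.
move=> ij; have cB := card_cyl j B.
set Z := [set f : tup | f j \in B] in cB.
have cX : (a i + #|A|) * #|Z| <= n * #|between P i j A B| + n * #|Z|.
  have -> : between P i j A B =
      [set f : tup | [&& f \in P, f i \in A & f j \in B]].
    by apply/setP => f; rewrite !inE.
  rewrite -(sum_card_upd (fun f => [&& f \in P, f i \in A & f j \in B]) i).
  rewrite -[#|Z|]sum1dep_card !big_distrr /= big_mkcond.
  rewrite [X in _ <= _ + X]big_mkcond -big_split /=.
  apply: leq_sum => f _; case: ifP => // fB; rewrite !muln1.
  have <- : nbr P i f :&: A =
      [set v | [&& upd f i v \in P, upd f i v i \in A & upd f i v j \in B]].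
    by apply/setP => v; rewrite !inE upd_same upd_other 1?eq_sym // fB andbT.
  apply: leq_trans (leq_add (deg_ge i f) (leqnn _)) _.
  rewrite -cardsUI addnC leq_add2l.
  by apply: leq_trans (max_card _) _; rewrite card_ord.
nia.
Qed.

(** A tuple with [i]-th coordinate in [A] has at least [a j] completions in part
    [j].  The ones lost to [B] are counted by [between], and the others fill the
    [n - #|B|] points outside [B] up to [n - #|B| - a j]. *)
Lemma nonedges_across i j (A B : {set 'I_n}) : i != j ->
  n ^ 2 * #|[set e : tup | [&& e \notin P, e i \in A & e j \notin B]]|
      + (a j + #|B|) * #|A| * n ^ k
    <= n * #|A| * n ^ k + n ^ 2 * #|between P i j A B|.
Proof.
move=> ij; have cA := card_cyl i A.
set Z := [set f : tup | f i \in A] in cA; set Y := [set e : tup | _].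
have cX : n * #|Y| + (a j + #|B|) * #|Z|
    <= n * #|Z| + n * #|between P i j A B|.
  have -> : between P i j A B =
      [set f : tup | [&& f \in P, f i \in A & f j \in B]].
    by apply/setP => f; rewrite !inE.
  rewrite -(sum_card_upd (fun f => [&& f \in P, f i \in A & f j \in B]) j).
  rewrite -(sum_card_upd (fun f => [&& f \notin P, f i \in A & f j \notin B]) j).
  rewrite -[#|Z|]sum1dep_card !big_distrr /=.
  rewrite [X in _ + X <= _]big_mkcond -big_split /=.
  rewrite [X in _ <= X + _]big_mkcond -big_split /=.
  apply: leq_sum => f _; case: ifP => fA; last first.
    rewrite addn0 eq_card0 // => v; rewrite !inE upd_other //.
    by rewrite fA andbF.
  rewrite !muln1.
  have -> : [set v | [&& upd f j v \notin P, upd f j v i \in A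
                        & upd f j v j \notin B]] = ~: (nbr P j f :|: B).
    apply/setP => v; rewrite !inE upd_same upd_other // fA.
    by rewrite negb_or.
  have -> : [set v | [&& upd f j v \in P, upd f j v i \in A
                        & upd f j v j \in B]] = nbr P j f :&: B.
    by apply/setP => v; rewrite !inE upd_same upd_other // fA.
  apply: leq_trans (leq_add (leqnn _) (leq_add (deg_ge j f) (leqnn _))) _.
  rewrite -cardsUI addnA leq_add2r [X in X <= _]addnC cardsC card_ord //.
nia.
Qed.

End Codegrees.
End Tuples.

(** * Matchings of tuples and absorption *)
Section TupleMatchings.
Variables (k n : nat).
Hypothesis k_gt0 : 0 < k.
Local Notation tup := {ffun 'I_k -> 'I_n}.
Implicit Types (P M N : {set tup}) (f g h e : tup) (i j : 'I_k) (v : 'I_n).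

Definition disj f g := [forall i, f i != g i].

Lemma disjP f g : reflect (forall i, f i <> g i) (disj f g).
Proof.
by apply: (iffP forallP) => fg i; [apply/eqP | apply/eqP; apply: fg].
Qed.

Lemma disjC f g : disj f g = disj g f.
Proof. by apply: eq_forallb => i; rewrite eq_sym. Qed.

Lemma disj_neq f g : disj f g -> f != g.
Proof.
by move/disjP => fg; apply/eqP => e; apply: (fg (Ordinal k_gt0)); rewrite e.
Qed.

Definition tmatching P M :=
  (M \subset P) && [forall h in M, forall g in M, (h != g) ==> disj h g].

Lemma tmatchingP P M :
  reflect ({subset M <= P} /\ {in M &, forall h g, h != g -> disj h g})
          (tmatching P M).
Proof.
apply: (iffP andP) => -[/subsetP sMP dM]; split=> //.
  by move=> h g hM gM; move/forall_inP/(_ h hM)/forall_inP/(_ g gM)/implyP: dM.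
apply/forall_inP => h hM; apply/forall_inP => g gM; apply/implyP; exact: dM.
Qed.

Lemma tmatching0 P : tmatching P set0.
Proof. by apply/tmatchingP; split=> [h|h g]; rewrite inE. Qed.

Lemma tmatching_inj P M i : tmatching P M -> {in M &, injective (fun h => h i)}.
Proof.
move=> /tmatchingP[_ dM] h g hM gM hg; apply: contra_eq (erefl (h i)) => hDg.
by rewrite [X in _ != X]hg; apply/eqP; apply/disjP; apply: dM.
Qed.

Lemma card_tmatching P M : tmatching P M -> #|M| <= n.
Proof.
move=> mM; rewrite -(card_in_imset (tmatching_inj (i := Ordinal k_gt0) mM)).
by apply: leq_trans (max_card _) _; rewrite card_ord.
Qed.

(** Every enlargement of a matching below replaces some of its edges one for one
    and adds one new edge. *)
Lemma augment P M (psi : tup -> tup) f :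
    tmatching P M -> (forall h, h \in M -> psi h \in P) ->
    {in M &, forall h g, h != g -> disj (psi h) (psi g)} ->
    f \in P -> (forall h, h \in M -> disj f (psi h)) ->
  tmatching P (f |: psi @: M) /\ #|f |: psi @: M| = #|M|.+1.
Proof.
move=> mM psiP psiD fP fD; split.
  apply/tmatchingP; split.
    by move=> e /setU1P[->|/imsetP[h hM ->]] //; apply: psiP.
  move=> e1 e2 /setU1P[->|/imsetP[h hM ->]] /setU1P[->|/imsetP[g gM ->]].
  - by rewrite eqxx.
  - by move=> _; apply: fD.
  - by move=> _; rewrite disjC; apply: fD.
  - move=> ne; apply: psiD => //; apply: contra_neq ne => -> //.
rewrite cardsU1 card_in_imset => [|h g hM gM hg].
  case: imsetP => [[h hM ef]|//].
  by have := disj_neq (fD h hM); rewrite -ef eqxx.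
by apply: contra_eq (hg) => ne; apply: disj_neq; apply: psiD.
Qed.

Definition unmatched M f := [forall h in M, disj h f].

Lemma unmatchedP M f : reflect (forall h i, h \in M -> h i <> f i) (unmatched M f).
Proof.
apply: (iffP forall_inP) => fr h; first by move=> i /fr/disjP; apply.
by move=> hM; apply/disjP => i; apply: fr.
Qed.

(** The uncovered vertices of a part number [n - #|M|] whatever the part, so
    they can be grouped into that many disjoint tuples. *)
Lemma free_tuples P M (J : finType) :
    tmatching P M -> #|J| + #|M| <= n ->
  exists r : J -> tup,
    (forall l, unmatched M (r l)) /\ (forall l l', l != l' -> disj (r l) (r l')).
Proof.
move=> mM leJ; pose U i := ~: [set h i | h : tup in M].
have cU i : #|J| <= #|U i|.
  have := cardsC [set h i | h : tup in M]; rewrite -/(U i) card_ord.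
  by rewrite (card_in_imset (tmatching_inj (i := i) mM)); lia.
pose r l : tup := [ffun i => enum_val (widen_ord (cU i) (enum_rank l))].
exists r; split=> [l|l l' ll'].
  apply/unmatchedP => h i hM eh.
  have : r l i \in U i by rewrite ffunE enum_valP.
  by rewrite inE -eh (imset_f (fun h : tup => h i)).
apply/disjP => i; rewrite !ffunE => /enum_val_inj/(congr1 val)/= e.
by case/eqP: ll'; apply: enum_rank_inj; apply: val_inj.
Qed.

(** This is the augmentation behind both absorption and the near-perfect
    matching: the edge [h] gives one vertex to [f] and another one to [g]. *)
Lemma swap P M h f g i j :
    tmatching P M -> h \in M -> unmatched M f -> unmatched M g -> disj f g -> i != j ->
    h i \in nbr P i f -> h j \in nbr P j g ->
  exists M', [/\ tmatching P M', M :\ h \subset M' & #|M'| = #|M|.+1].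
Proof.
move=> mM hM /unmatchedP fr /unmatchedP gr /disjP fg ij; rewrite !inE => hf hg.
have [sP dM] := tmatchingP _ _ mM.
pose psi h' := if h' == h then upd f i (h i) else h'.
have psih h' : h' \in M -> h' != h -> disj (upd f i (h i)) h'.
  move=> h'M ne; apply/disjP => m; have [->|mi] := eqVneq m i.
    by rewrite upd_same; apply/disjP; apply: dM; rewrite // eq_sym.
  by rewrite upd_other // => /esym; apply: fr.
have [|h' g' h'M g'M|//|h' h'M|m1 m2] :=
    @augment P M psi (upd g j (h j)) mM.
- by move=> h' h'M; rewrite /psi; case: ifP => _ //; apply: sP.
- rewrite /psi; have [->|nh] := eqVneq h' h.
    by have [//|ng _] := eqVneq g' h; apply: psih.
  have [_|ng ne] := eqVneq g' h; last exact: dM.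
  by move=> _; rewrite disjC; apply: psih.
- rewrite /psi; have [_|nh] := eqVneq h' h; apply/disjP => m.
    have [->|mj] := eqVneq m j.
      by rewrite upd_same upd_other 1?eq_sym //; apply: fr.
    rewrite [X in X <> _]upd_other //; have [->|mi] := eqVneq m i.
      by rewrite upd_same => /esym; apply: gr.
    by rewrite upd_other // => /esym; apply: fg.
  have [->|mj] := eqVneq m j.
    by rewrite upd_same; apply/disjP; apply: dM; rewrite // eq_sym.
  by rewrite upd_other // => /esym; apply: gr.
exists (upd g j (h j) |: psi @: M); split=> //.
apply/subsetP => e /setD1P[ne eM]; apply/setU1P; right; apply/imsetP.
by exists e; rewrite // /psi (negPf ne).
Qed.

(** Each swap lowers the number of uncovered vertices per part by one and costs a
    pair at most one of its absorbers, so [w] absorbers per pair suffice.  The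
    vertices of a swapped edge outside parts [i] and [j] become uncovered, which
    is why all pairs need absorbers and not only the initially uncovered ones. *)
Lemma absorb P (i j : 'I_k) w M : i != j ->
    tmatching P M -> n - #|M| <= w ->
    (forall f g, w <= #|M :&: between P i j (nbr P i f) (nbr P j g)|.+1) ->
  exists M', tmatching P M' /\ n - 1 <= #|M'|.
Proof.
move=> ij; elim: w M => [|w IH] M mM leM abs.
  by exists M; split=> //; lia.
have [le1|gt1] := leqP (n - #|M|) 1; first by exists M; split=> //; lia.
have [|r [rM rD]] := @free_tuples P M bool mM.
  by rewrite card_bool; lia.
pose X := between P i j (nbr P i (r true)) (nbr P j (r false)).
have := abs (r true) (r false); rewrite -/X.
have [->|[h]] := set_0Vmem (M :&: X); first by rewrite cards0; lia.
rewrite in_setI !inE => /andP[hM /and3P[hP hi hj]] _.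
have [||M' [mM' sM' cM']] := @swap P M h (r true) (r false) i j mM hM
  (rM _) (rM _) (rD true false isT) ij; rewrite ?inE //.
apply: (IH M') => [//||f g]; first by rewrite cM' subnS -subn1 leq_subLR.
apply: (@leq_trans #|(M :&: between P i j (nbr P i f) (nbr P j g)) :\ h|.+1).
  have := abs f g; rewrite (cardsD1 h) ltnS => /leq_trans; apply.
  by rewrite -add1n leq_add2r leq_b1.
rewrite ltnS; apply: subset_leq_card.
by rewrite -setIDAC; apply: setSI.
Qed.

(** The weak form of Hall's theorem in which a greedy choice succeeds: every set
    is as large as the number of sets. *)
Lemma distinct_choice (J : finType) (D : 'I_k -> {set J}) :
  (forall i, k <= #|D i|) ->
  exists2 l : 'I_k -> J, injective l & forall i, l i \in D i.
Proof.
move=> leD.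
suff /(_ k (leqnn k)) [l lD lI] : forall m, m <= k -> exists2 l : 'I_k -> J,
    (forall i, l i \in D i) & {in [pred i : 'I_k | i < m] &, injective l}.
  exists l => // i j e; exact: lI (ltn_ord i) (ltn_ord j) e.
elim=> [_|m IH ltmk].
  have ne i : exists x, x \in D i.
    by apply/card_gt0P; apply: leq_trans (leD i).
  by exists (fun i => xchoose (ne i)) => // i; apply: xchooseP.
have [l lD lI] := IH (ltnW ltmk); pose m' := Ordinal ltmk.
pose L := [set l i | i : 'I_k & i < m].
have [x xD xL] : exists2 x, x \in D m' & x \notin L.
  have : 0 < #|D m' :\: L|.
    rewrite cardsD subn_gt0; apply: leq_ltn_trans (leq_trans ltmk (leD m')).
    apply: leq_trans (subset_leq_card (subsetIr _ _)) _.
    apply: leq_trans (leq_imset_card _ _) _.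
    have wI : injective (widen_ord (ltnW ltmk)).
      by move=> u v /(congr1 val) /= /val_inj.
    rewrite -[X in _ <= X]card_ord -(card_codom wI).
    apply: subset_leq_card; apply/subsetP => i; rewrite inE => im.
    by apply/codomP; exists (Ordinal (im : i < m)); apply: val_inj.
  by case/card_gt0P => x /setDP[]; exists x.
exists (fun i => if i == m' then x else l i) => [i|i j].
  by case: eqP => [->|_].
rewrite !inE !ltnS => im jm; case: eqP => [->|ni]; case: eqP => [->|nj] // e.
- case/negP: xL; rewrite e; apply: imset_f; rewrite inE ltn_neqAle jm andbT.
  by apply/eqP => e'; apply: nj; apply: val_inj.
- case/negP: xL; rewrite -e; apply: imset_f; rewrite inE ltn_neqAle im andbT.
  by apply/eqP => e'; apply: ni; apply: val_inj.
- apply: lI => //; rewrite !inE ltn_neqAle ?im ?jm andbT.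
    by apply/eqP => e'; apply: ni; apply: val_inj.
  by apply/eqP => e'; apply: nj; apply: val_inj.
Qed.

End TupleMatchings.

(** * A maximum matching is nearly perfect unless there is a space barrier *)
Section Completion.
Variables (k n : nat).
Hypothesis k_gt0 : 0 < k.
Local Notation tup := {ffun 'I_k -> 'I_n}.
Implicit Types (f g h e : tup) (i j : 'I_k) (v : 'I_n).
Variables (P M0 M : {set tup}) (a : 'I_k -> nat).
Hypothesis deg_ge : forall i f, a i <= #|nbr P i f|.
Hypothesis mM : tmatching P M.
Hypothesis sM0M : M0 \subset M.
Hypothesis M_max :
  forall M', tmatching P M' -> M0 \subset M' -> #|M'| <= #|M|.
Variables (t : nat) (r : 'I_k * 'I_t -> tup).
Hypothesis r_free : forall l, unmatched M (r l).
Hypothesis r_disj : forall l l', l != l' -> disj (r l) (r l').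

Definition hits i h := [set l | h i \in nbr P i (r (i, l))].
(** The threshold [k] leaves room to choose distinct uncovered tuples for up to
    [k] edges at once. *)
Definition hit_edges i := [set h in M :\: M0 | k <= #|hits i h|].

Let inM i h : h \in hit_edges i -> h \in M.
Proof. by rewrite !inE => /andP[/andP[]]. Qed.

(** Otherwise [upd (r (i, l)) i v] could be added to [M]. *)
Lemma nbr_covered i l v : v \in nbr P i (r (i, l)) -> exists2 h, h \in M & h i = v.
Proof.
rewrite inE => vP.
have [/existsP[h /andP[hM /eqP hv]]|] := boolP [exists h, (h \in M) && (h i == v)].
  by exists h.
rewrite negb_exists => /forallP nov.
have [sP dM] := tmatchingP _ _ mM.
have [|h g hM gM|//|h hM|m1 m2] :=
    @augment k n k_gt0 P M id (upd (r (i, l)) i v) mM.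
- exact: sP.
- exact: dM.
- apply/disjP => m; have [->|mi] := eqVneq m i.
    by rewrite upd_same => e; have := nov h; rewrite hM -e eqxx.
  by rewrite upd_other // => /esym; apply: (unmatchedP _ _ (r_free _)).
rewrite imset_id in m1 m2.
by have := M_max m1 (subset_trans sM0M (subsetUr _ _)); rewrite m2 ltnn.
Qed.

(** An edge in both families could be swapped for two edges. *)
Lemma hit_edges_disjoint i j h : h \in hit_edges i -> h \in hit_edges j -> i = j.
Proof.
move=> hi hj; apply/eqP; apply: contraT => ij.
have ne m : h \in hit_edges m -> exists l, l \in hits m h.
  rewrite inE => /andP[_ /(leq_trans k_gt0)]; exact: (fun H => card_gt0P H).
have [[l li] [l' lj]] := (ne i hi, ne j hj).
move: li lj; rewrite ![_ \in hits _ _]inE => li lj.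
have lD : (i, l) != (j, l').
  by apply: contra_neq ij => -[].
have [M' [mM' sM' cM']] :=
  swap k_gt0 mM (inM hi) (r_free _) (r_free _) (r_disj lD) ij li lj.
have sM0M' : M0 \subset M'.
  apply: subset_trans sM'; rewrite subsetD1 sM0M /=.
  by move: hi; rewrite !inE; case: (h \in M0).
by have := M_max mM' sM0M'; rewrite cM' ltnn.
Qed.

(** Double counting of the pairs [(h, l)] with [l] in [hits i h]: each [l] occurs
    for at least [a i] edges, an edge of [M0] or of [hit_edges i] is in at most
    [t] pairs, and each of the remaining ones in less than [k]. *)
Lemma hit_edges_large i : t * a i <= t * (#|M0| + #|hit_edges i|) + k * n.
Proof.
have step1 (l : 'I_t) : a i <= \sum_(h in M) (l \in hits i h).
  apply: leq_trans (deg_ge i (r (i, l))) _.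
  have -> : \sum_(h in M) (l \in hits i h) = #|[set h in M | l \in hits i h]|.
    rewrite -sum1dep_card [RHS]big_mkcondr /=.
    by apply: eq_bigr => h _; case: (_ \in _).
  rewrite -(card_in_imset (f := fun h => h i)) => [|h g].
    apply: subset_leq_card; apply/subsetP => v vN.
    have [h hM hv] := nbr_covered vN.
    by apply/imsetP; exists h; rewrite // inE hM inE hv.
  rewrite !inE => /andP[hM _] /andP[gM _].
  exact: (tmatching_inj mM).
have -> : t * a i = \sum_(l < t) a i by rewrite sum_nat_const card_ord.
apply: (@leq_trans (\sum_(l < t) \sum_(h in M) (l \in hits i h))).
  by apply: leq_sum => l _; apply: step1.
rewrite exchange_big /=.
rewrite (eq_bigr (fun h => #|hits i h|)) => [|h _]; last first.
  by rewrite -sum1_card [RHS]big_mkcond /=; apply: eq_bigr => l _; case: (_ \in _).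
have bound h : h \in M ->
    #|hits i h| <= t * ((h \in M0) + (h \in hit_edges i)) + k.
  move=> hM; have := max_card (hits i h); rewrite card_ord.
  by rewrite [h \in hit_edges i]inE inE hM; case: (h \in M0); case: leqP; rewrite /= ; lia.
apply: leq_trans (leq_sum _ bound) _.
rewrite big_split /= -big_distrr /= big_split /= sum_nat_const mulnC.
rewrite mulnC [#|M| * k]mulnC.
apply: leq_add; last by rewrite leq_mul ?(card_tmatching k_gt0 mM).
rewrite leq_mul //; apply: leq_add.
  rewrite -[X in _ <= X]sum1_card big_mkcond [X in _ <= X]big_mkcond /=.
  by apply: leq_sum => h _; case: (h \in M); case: (h \in M0).
rewrite -[X in _ <= X]sum1_card big_mkcond [X in _ <= X]big_mkcond /=.
by apply: leq_sum => h _; case: (h \in M); case: (h \in hit_edges i).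
Qed.

Lemma sum_hit_edges : \sum_i #|hit_edges i| <= n.
Proof.
apply: leq_trans (card_tmatching k_gt0 mM); rewrite -[#|M|]sum1_card.
under eq_bigr do rewrite -sum1_card big_mkcond.
rewrite exchange_big [X in _ <= X]big_mkcond /=; apply: leq_sum => h _.
case: ifPn => hM; last first.
  by rewrite big1 // => i _; case: ifP => // /inM; rewrite (negPf hM).
have [/existsP[i hi]|] := boolP [exists i, h \in hit_edges i].
  rewrite (bigD1 i) //= hi big1 // => j ji; case: ifP => // hj.
  by case/eqP: ji; apply: hit_edges_disjoint hj hi.
rewrite negb_exists => /forallP nh; rewrite big1 // => i _.
by rewrite (negPf (nh i)).
Qed.

Definition others i := \bigcup_(j | j != i) hit_edges j.
Definition space i := [set h i | h : tup in others i].

Lemma card_space i : #|space i| + #|hit_edges i| = \sum_j #|hit_edges j|.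
Proof.
rewrite card_in_imset => [|h g]; last first.
  move=> /bigcupP[j _ /inM hM] /bigcupP[j' _ /inM gM].
  exact: (tmatching_inj mM).
rewrite [RHS](bigD1 i) //= addnC; congr (_ + _).
rewrite -sum1_card; under [RHS]eq_bigr do rewrite -sum1_card big_mkcond.
rewrite exchange_big big_mkcond /=; apply: eq_bigr => h _.
case: ifPn => [/bigcupP[j ji hj]|nh].
  rewrite (bigD1 j) //= hj big1 ?addn0 // => j' /andP[_ ne].
  by case: ifP => // hj'; case/eqP: ne; apply: hit_edges_disjoint hj' hj.
rewrite big1 // => j ji; case: ifP => // hj.
by case/bigcupP: nh; exists j.
Qed.

(** An edge [f] inside the space can be added to [M]: each edge [h i] that it
    meets is hit in some part [s i], where its vertex is not on [f], and is
    replaced by the completion of an uncovered tuple through its vertex in that part. *)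
Lemma space_independent f : f \in P -> (forall i, f i \in space i) -> False.
Proof.
move=> fP fC; have [sP dM] := tmatchingP _ _ mM.
have ex i : exists hs : tup * 'I_k,
    [&& hs.2 != i, hs.1 \in hit_edges hs.2 & hs.1 i == f i].
  have /imsetP[h /bigcupP[s si hs] e] := fC i.
  by exists (h, s); rewrite /= si hs e eqxx.
pose hs i := xchoose (ex i); pose h i : tup := (hs i).1; pose s i : 'I_k := (hs i).2.
have hsP i : [/\ s i != i, h i \in hit_edges (s i) & h i i = f i].
  by have /and3P[? ? /eqP] := xchooseP (ex i).
pose D i := hits (s i) (h i).
have [|l l_inj lD] := @distinct_choice k k_gt0 _ D.
  by move=> i; have [_] := hsP i; rewrite inE => /andP[_].
(* [f] may meet the same edge in several parts; one of the corresponding indices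
   decides how this edge is replaced. *)
pose psi g := if [pick i | h i == g] is Some i
              then upd (r (s i, l i)) (s i) (h i (s i)) else g.
have psiP g : (exists2 i, h i = g & psi g = upd (r (s i, l i)) (s i) (g (s i)))
           \/ (forall i, h i != g) /\ psi g = g.
  rewrite /psi; case: pickP => [i /eqP <-|no]; first by left; exists i.
  by right; split=> // i; rewrite no.
have hM i : h i \in M by have [_ /inM] := hsP i.
(* Otherwise [h i] and [h (s i)] coincide, and this edge lies in two of the
   disjoint families of hit edges. *)
have slot i : f (s i) <> h i (s i).
  move=> e; have [si1 si2 si3] := hsP i; have [sj1 sj2 sj3] := hsP (s i).
  have hh : h (s i) = h i.
    apply: (tmatching_inj mM (i := s i)) => //; by rewrite /= sj3 e.
  by case/eqP: sj1; rewrite hh in sj2; apply: hit_edges_disjoint sj2 si2.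
have [||//||m1 m2] := @augment k n k_gt0 P M psi f mM.
- move=> g gM; case: (psiP g) => [[i hg ->]|[_ ->]]; last exact: sP.
  by have := lD i; rewrite /D -hg !inE.
- have mixed g g' i : g \in M -> g' \in M -> g != g' -> h i = g ->
      disj (upd (r (s i, l i)) (s i) (g (s i))) g'.
    move=> gM g'M ne hg; apply/disjP => m; have [->|ms] := eqVneq m (s i).
      by rewrite upd_same; apply/disjP; apply: dM.
    by rewrite upd_other // => /esym; apply: (unmatchedP _ _ (r_free _)).
  move=> g g' gM g'M ne.
  case: (psiP g) => [[i hg ->]|[ng ->]]; case: (psiP g') => [[j hg' ->]|[ng' ->]].
  + apply/disjP => m; have [->|mi] := eqVneq m (s i).
      rewrite upd_same; have [->|mj] := eqVneq (s i) (s j).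
        by rewrite upd_same; apply/disjP; apply: dM.
      by rewrite upd_other //; apply: (unmatchedP _ _ (r_free _)).
    rewrite [X in X <> _]upd_other //; have [->|mj] := eqVneq m (s j).
      by rewrite upd_same => /esym; apply: (unmatchedP _ _ (r_free _)).
    rewrite upd_other //; apply/disjP; apply: r_disj.
    apply: contra_neq ne => -[_ /l_inj e]; by rewrite -hg -hg' e.
  + exact: mixed.
  + by rewrite disjC; apply: mixed; rewrite // eq_sym.
  + exact: dM.
- move=> g gM; case: (psiP g) => [[i hg ->]|[ng ->]]; apply/disjP => m.
    have [->|ms] := eqVneq m (s i); first by rewrite upd_same -hg.
    rewrite upd_other //; have [_ _ <-] := hsP m.
    exact: (unmatchedP _ _ (r_free _)).
  have [_ _ <-] := hsP m; apply/disjP; exact: dM.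
have sM' : M0 \subset f |: psi @: M.
  apply/subsetP => g gM0; apply/setU1P; right; apply/imsetP.
  exists g; first exact: (subsetP sM0M).
  case: (psiP g) => [[i hg _]|[_ ->]] //.
  by have [_] := hsP i; rewrite hg !inE gM0.
by have := M_max m1 sM'; rewrite m2 ltnn.
Qed.

End Completion.

(** Here [m i] is the number of edges hit in part [i]; the second condition says
    that [a i <= m i] up to the size of [M0] and the error [k * n / t]. *)
Lemma near_perfect_or_space k n (P M0 : {set {ffun 'I_k -> 'I_n}})
    (a : 'I_k -> nat) t :
    0 < k -> (forall i f, a i <= #|nbr P i f|) -> tmatching P M0 ->
  exists2 M, tmatching P M /\ M0 \subset M &
    n - #|M| < k * t \/
    exists (m : 'I_k -> nat) (C : 'I_k -> {set 'I_n}),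
      [/\ \sum_i m i <= n,
          forall i, t * a i <= t * (#|M0| + m i) + k * n,
          forall i, #|C i| + m i = \sum_j m j
        & forall f : {ffun 'I_k -> 'I_n},
            f \in P -> (forall i, f i \in C i) -> False].
Proof.
move=> k0 deg mM0.
pose ok M := tmatching P M && (M0 \subset M).
have ok0 : ok M0 by rewrite /ok mM0 subxx.
case: (@arg_maxnP _ M0 ok (fun M : {set _} => #|M|) ok0) => M /andP[mM sM] Mmax.
exists M => //; have [lt|ge] := ltnP (n - #|M|) (k * t); [by left | right].
have M_max M' : tmatching P M' -> M0 \subset M' -> #|M'| <= #|M|.
  by move=> mM' sM'; apply: Mmax; rewrite /ok mM' sM'.
have [|r [rF rD]] := @free_tuples k n k0 P M ('I_k * 'I_t)%type mM.
  by rewrite card_prod !card_ord; have := card_tmatching k0 mM; lia.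
exists (fun i => #|hit_edges P M0 M r i|), (space P M0 M r); split.
- exact: (sum_hit_edges k0 mM sM M_max rF rD).
- exact: (hit_edges_large k0 deg mM sM M_max rF).
- exact: (card_space k0 mM sM M_max rF rD).
- exact: (space_independent k0 mM sM M_max rF rD).
Qed.

(** * A small matching with absorbers for all pairs *)
Section Greedy.
Variables (R : realFieldType) (k n : nat).
Hypotheses (k_gt0 : 0 < k) (n_gt0 : 0 < n).
Local Notation tup := {ffun 'I_k -> 'I_n}.
Implicit Types (M : {set tup}) (f g h e : tup).
Variables (P : {set tup}) (J : finType) (X : J -> {set tup}) (c : R).
Hypotheses (c_gt0 : (0 < c)%R) (c_le1 : (c <= 1)%R).
Hypothesis X_sub : forall j, X j \subset P.
Hypothesis X_large : forall j, (c * (n ^ k)%:R <= #|X j|%:R)%R.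

Lemma card_matched M : n * #|[set e | ~~ unmatched M e]| <= #|M| * k * n ^ k.
Proof.
have cyl h (i : 'I_k) : n * #|[set e : tup | e i \in [set h i]]| = n ^ k.
  by rewrite card_cyl cards1 mul1n.
have -> : #|M| * k * n ^ k
    = n * \sum_(h in M) \sum_i #|[set e : tup | e i \in [set h i]]|.
  rewrite -mulnA -sum_nat_const big_distrr; apply: eq_bigr => h _ /=.
  rewrite big_distrr /=; under eq_bigr do rewrite cyl.
  by rewrite sum_nat_const card_ord.
rewrite leq_mul2l; apply/orP; right.
rewrite -sum1dep_card big_mkcond /=.
under [X in _ <= X]eq_bigr => h _ do
  (under eq_bigr => i _ do rewrite -sum1dep_card big_mkcond; rewrite exchange_big).
rewrite exchange_big /=; apply: leq_sum => e _; case: ifP => // /forall_inPn[h hM].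
case/forallPn => i /negPn/eqP hi.
by rewrite (bigD1 h) //= (bigD1 i) //= inE hi eqxx.
Qed.

Local Open Scope ring_scope.

(** Averaging: at most half of each [X j] meets [M], so a random tuple lies in
    [X j] and avoids [M] with probability at least [c / 2]. *)
Lemma popular_edge M (J' : {set J}) :
    ((#|M| * k)%N%:R <= c / 2 * n%:R :> R) -> J' != set0 ->
  exists e, [/\ e \in P, unmatched M e
              & c / 2 * #|J'|%:R <= #|[set j in J' | e \in X j]|%:R :> R].
Proof.
move=> leM J'0; pose F := [set e | unmatched M e].
pose cnt e := #|[set j in J' | e \in X j]|.
pose B : R := c / 2 * #|J'|%:R.
have J'_gt0 : 0 < #|J'|%:R :> R by rewrite ltr0n card_gt0.
have B_gt0 : 0 < B by rewrite /B mulr_gt0 // divr_gt0.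
have nR : 0 < n%:R :> R by rewrite ltr0n.
have nkR : 0 < (n ^ k)%:R :> R by rewrite ltr0n expn_gt0 n_gt0.
have count : (\sum_(j in J') #|X j :&: F| = \sum_(e in F) cnt e)%N.
  under eq_bigr => j _ do rewrite -sum1_card.
  under [RHS]eq_bigr => e _ do rewrite /cnt -sum1dep_card.
  rewrite (exchange_big_dep (mem F)) /=; last by move=> j e _ /setIP[].
  apply: eq_bigr => e eF; apply: eq_bigl => j.
  by rewrite in_setI eF andbT.
have blocked : #|[set e | ~~ unmatched M e]|%:R <= c / 2 * (n ^ k)%:R :> R.
  have := card_matched M; rewrite -(ler_nat R) !natrM => H.
  rewrite natrM in leM.
  rewrite -(ler_pM2l nR); apply: le_trans H _.
  by rewrite mulrA [n%:R * _]mulrC ler_wpM2r // ltW.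
have big j : c / 2 * (n ^ k)%:R <= #|X j :&: F|%:R :> R.
  have := X_large j; have : (#|X j| <= #|X j :&: F| + #|~: F|)%N.
    by rewrite -(cardsID F (X j)) leq_add2l setDE subset_leq_card ?subsetIr.
  have -> : ~: F = [set e | ~~ unmatched M e] by apply/setP => e; rewrite !inE.
  rewrite -(ler_nat R) natrD => h1 h2; lra.
have [/existsP[e /andP[eF cB]]|] := boolP [exists e, (e \in F) && (B <= (cnt e)%:R)].
  exists e; split=> //; last by move: eF; rewrite inE.
  have : (0 < cnt e)%N by rewrite -(ltr_nat R); apply: lt_le_trans cB.
  by case/card_gt0P => j; rewrite inE => /andP[_]; apply: (subsetP (X_sub j)).
rewrite negb_exists => /forallP small; exfalso.
have lower : B * (n ^ k)%:R <= (\sum_(e in F) cnt e)%N%:R.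
  rewrite -count natr_sum /B mulrAC.
  rewrite [c / 2 * (n ^ k)%:R * _]mulr_natr -sumr_const.
  by apply: ler_sum.
have [F0|[e0 e0F]] := set_0Vmem F.
  have : 0 < B * (n ^ k)%:R by rewrite mulr_gt0.
  by move: lower; rewrite F0 big_set0; lra.
have hasF : has (mem F) (index_enum tup).
  by apply/hasP; exists e0; rewrite ?mem_index_enum.
have : (\sum_(e in F) cnt e)%N%:R < \sum_(e in F) B.
  rewrite natr_sum; apply: ltr_sum => // e eF.
  by have := small e; rewrite eF /= -ltNge.
rewrite sumr_const => up.
have : B *+ #|F| <= B * (n ^ k)%:R.
  rewrite -[B *+ _]mulr_natr ler_pM2l // ler_nat.
  by apply: leq_trans (max_card _) _; rewrite card_ffun !card_ord.
lra.
Qed.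

(** Taking a popular edge at each step multiplies the number of indices without
    a new member of [X j] by at most [1 - c / 2]. *)
Lemma greedy_hits M0 N : tmatching P M0 ->
    ((#|M0| + N) * k)%N%:R <= c / 2 * n%:R :> R ->
  exists M, [/\ tmatching P M, M0 \subset M, (#|M| <= #|M0| + N)%N &
    #|[set j | (#|M :&: X j| <= #|M0 :&: X j|)%N]|%:R
      <= #|J|%:R * (1 - c / 2) ^+ N].
Proof.
have q_ge0 : 0 <= 1 - c / 2 by move: c_gt0 c_le1; lra.
move=> mM0; elim: N => [|N IH] leN.
  exists M0; split; rewrite ?addn0 // expr0 mulr1 ler_nat; exact: max_card.
have [|M [mM sM cM unhit]] := IH.
  by apply: le_trans leN; rewrite ler_nat leq_mul // addnS.
set J' := [set j | _] in unhit.
have [J'0|J'n0] := eqVneq J' set0.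
  exists M; split=> //; first by rewrite addnS leqW.
  rewrite -/J' J'0 cards0; apply: mulr_ge0; first exact: ler0n.
  exact: exprn_ge0.
have [|e [eP eM pop]] := @popular_edge M J' _ J'n0.
  by apply: le_trans leN; rewrite ler_nat leq_mul // addnS leqW.
have [sP dM] := tmatchingP _ _ mM.
have [||//||m1 m2] := @augment k n k_gt0 P M id e mM.
- exact: sP.
- exact: dM.
- by move=> h hM; rewrite disjC; exact: (forall_inP eM).
rewrite imset_id in m1 m2; exists (e |: M); split=> //.
- exact: subset_trans sM (subsetUr _ _).
- by rewrite m2 addnS ltnS.
have eNM : e \notin M.
  by apply: contraTN eM => eM; apply/negP => /unmatchedP/(_ e (Ordinal k_gt0) eM).
have sub : [set j | (#|(e |: M) :&: X j| <= #|M0 :&: X j|)%N]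
    \subset J' :\: [set j in J' | e \in X j].
  apply/subsetP => j; rewrite !inE => lej.
  have leMj : (#|M :&: X j| <= #|M0 :&: X j|)%N.
    apply: leq_trans lej; apply: subset_leq_card.
    by apply: setSI; apply: subsetUr.
  rewrite leMj andbT /=; apply/negP => eX.
  have ltM : (#|M :&: X j| < #|(e |: M) :&: X j|)%N.
    rewrite setIUl (_ : [set e] :&: X j = [set e]); last first.
      by apply/setIidPl; rewrite sub1set.
    by rewrite cardsU1 inE (negPf eNM).
  have := leq_ltn_trans (leq_trans lej (subset_leq_card (setSI (X j) sM))) ltM.
  by rewrite ltnn.
have subJ : [set j in J' | e \in X j] \subset J'.
  by apply/subsetP => j; rewrite inE => /andP[].
have := subset_leq_card sub; rewrite cardsD (setIidPr subJ).
rewrite leq_subRL ?subset_leq_card // -(ler_nat R) natrD exprSr mulrA => leb.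
have : #|J'|%:R * (1 - c / 2) <= #|J|%:R * (1 - c / 2) ^+ N * (1 - c / 2).
  exact: ler_wpM2r unhit.
lra.
Qed.

(** Fewer than one index remaining means none; [K] rounds give [K] members. *)
Lemma absorbing_family K N :
    (K * N * k)%N%:R <= c / 2 * n%:R :> R ->
    #|J|%:R * (1 - c / 2) ^+ N < 1 ->
  exists M, [/\ tmatching P M, (#|M| <= K * N)%N
              & forall j, (K <= #|M :&: X j|)%N].
Proof.
move=> leK ltN; elim: K leK => [|K IH] leK.
  by exists set0; rewrite tmatching0 cards0.
have [|M0 [mM0 cM0 hit0]] := IH.
  by apply: le_trans leK; rewrite ler_nat !leq_mul2r leqnSn !orbT.
have [|M [mM sM cM hit]] := @greedy_hits M0 N mM0.
  by apply: le_trans leK; rewrite ler_nat leq_mul // mulSn addnC leq_add2l.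
exists M; split=> // [|j].
  by apply: leq_trans cM _; rewrite mulSn addnC leq_add2l.
have := le_lt_trans hit ltN; rewrite (ltr_nat R _ 1) ltnS leqn0 cards_eq0.
move/eqP/setP/(_ j); rewrite !inE => /negbT; rewrite -ltnNge.
exact: leq_ltn_trans (hit0 j).
Qed.

End Greedy.

(** * Few absorbers force the parity structure *)
Section Parity.
Variables (R : realFieldType) (k n : nat).
Local Notation tup := {ffun 'I_k -> 'I_n}.
Local Open Scope ring_scope.

(** The arithmetic of [few_between_parity], with [N] for [n], [K] for [n ^ k],
    [p], [q] for the sizes of the two neighbourhoods, [X] for the number of edges
    between them and [Y1], [Y2] for the numbers of missing edges on either side.
    The premise [(1 - s) * N <= a1 + a2] is conditional because the sum of all
    codegrees bounds [a1 + a2] from below only once [a3] is small. *)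
Lemma parity_arith (e N K a1 a2 a3 p q X Y1 Y2 s : R) :
    0 < e -> e <= 2^-1 -> 0 < N -> 0 < K -> 0 <= s ->
    a2 <= a1 -> e * N <= a2 -> a1 <= p -> a2 <= q -> p <= N -> q <= N ->
    (a3 < e * N -> (1 - s) * N <= a1 + a2) ->
    X < e ^+ 3 * K ->
    a3 * (p * q) * K <= N ^+ 3 * X ->
    (a1 + p) * q * K <= N ^+ 2 * X + N * q * K ->
    (a2 + q) * p * K <= N ^+ 2 * X + N * p * K ->
    N ^+ 2 * Y1 + (a2 + q) * p * K <= N * p * K + N ^+ 2 * X ->
    N ^+ 2 * Y2 + (a1 + p) * q * K <= N * q * K + N ^+ 2 * X ->
  [/\ a3 < e * N, p + a1 < (1 + e) * N, q + a2 < (1 + e) * N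
    & Y1 + Y2 <= (e + 3 * s + 2 * e ^+ 3) * K].
Proof.
move=> e0 e1 N0 K0 s0 a21 a2e a1p a2q pN qN sum few D3 D12 D21 Y1e Y2e.
have p_ge : e * N <= p := le_trans a2e (le_trans a21 a1p).
have q_ge : e * N <= q := le_trans a2e a2q.
have eN : 0 <= e * N by rewrite mulr_ge0 ?ltW.
have KN : 0 <= K := ltW K0.
have pq : (e * N) * (e * N) <= p * q by apply: ler_pM.
have F3 : N ^+ 3 * X < N ^+ 3 * (e ^+ 3 * K) by rewrite ltr_pM2l ?exprn_gt0.
have F2 : N ^+ 2 * X < N ^+ 2 * (e ^+ 3 * K) by rewrite ltr_pM2l ?exprn_gt0.
have e32 : e ^+ 3 <= e ^+ 2.
  by rewrite exprS ler_piMl ?exprn_ge0 ?ltW //; apply: le_lt_trans e1 _; lra.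
have a3s : a3 < e * N.
  rewrite ltNge; apply/negP => a3e.
  have : (e * N) * ((e * N) * (e * N)) * K <= a3 * (p * q) * K.
    by apply: ler_wpM2r => //; apply: ler_pM => //; rewrite mulr_ge0.
  have -> : (e * N) * ((e * N) * (e * N)) * K = N ^+ 3 * (e ^+ 3 * K) by ring.
  by move=> /le_trans/(_ D3); rewrite leNgt F3.
have sharp x y z : e * N <= z -> (x + y) * z * K <= N ^+ 2 * X + N * z * K ->
    y + x < (1 + e) * N.
  move=> zge H; rewrite ltNge; apply/negP => xy.
  have : (e * N) * (e * N) * K <= (x + y - N) * z * K.
    apply: ler_wpM2r => //; apply: ler_pM => //; move: xy; clear; lra.
  have -> : (e * N) * (e * N) * K = N ^+ 2 * (e ^+ 2 * K) by ring.
  have : N ^+ 2 * (e ^+ 3 * K) <= N ^+ 2 * (e ^+ 2 * K).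
    by rewrite ler_pM2l ?exprn_gt0 // ler_wpM2r.
  have -> : (x + y - N) * z * K = (x + y) * z * K - N * z * K by ring.
  move: H F2; clear; lra.
split=> //; [exact: sharp q_ge D12 | exact: sharp p_ge D21 |].
have miss x y z Y t : 0 <= t -> z <= N -> N - (x + y) <= t * N -> 0 <= z ->
    N ^+ 2 * Y + (x + y) * z * K <= N * z * K + N ^+ 2 * X -> Y <= (t + e ^+ 3) * K.
  move=> t0 zN xy z0 H.
  have : (N - (x + y)) * z * K <= (t * N) * N * K.
    apply: ler_wpM2r => //; apply: (@le_trans _ _ (t * N * z)).
      exact: ler_wpM2r.
    by apply: ler_wpM2l => //; rewrite mulr_ge0 // ltW.
  rewrite (_ : (N - (x + y)) * z * K = N * z * K - (x + y) * z * K); last by ring.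
  rewrite (_ : t * N * N * K = N ^+ 2 * (t * K)); last by ring.
  move=> H2; rewrite -(ler_pM2l (exprn_gt0 2 N0)) mulrDl mulrDr.
  by move: H H2 F2; clear; lra.
have sumN := sum a3s.
have pa := sharp _ _ _ q_ge D12.
have M1 : Y1 <= (e + 2 * s + e ^+ 3) * K.
  apply: miss Y1e => //; first by move: e0 s0; clear; lra.
    by move: pa sumN a1p a2q; clear; lra.
  exact: le_trans eN p_ge.
have M2 : Y2 <= (s + e ^+ 3) * K.
  apply: miss Y2e => //; first by move: a21 sumN a1p; clear; lra.
  exact: le_trans eN q_ge.
by move: M1 M2; clear; lra.
Qed.

(** The symmetric difference selects the tuples with an odd number of vertices in
    the union of [A] and [B]. *)
Definition parity_structure (P : {set tup}) (a : 'I_k -> nat) (theta : R)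
    (i1 i2 : 'I_k) (A B : {set 'I_n}) : Prop :=
  [/\ (2^-1 - theta) * n%:R <= (a i1)%:R <= (2^-1 + theta) * n%:R
      /\ (2^-1 - theta) * n%:R <= (a i2)%:R <= (2^-1 + theta) * n%:R,
      (2^-1 - theta) * n%:R <= #|A|%:R <= (2^-1 + theta) * n%:R
      /\ (2^-1 - theta) * n%:R <= #|B|%:R <= (2^-1 + theta) * n%:R,
      forall i : 'I_k, (2 <= i)%N -> (a i)%:R <= theta * n%:R
    & #|[set e : tup | (e \notin P) && ((e i1 \in A) (+) (e i2 \in B))]|%:R
        <= theta * n%:R ^+ k].

Lemma sum_codeg_le (a : 'I_k -> nat) (i1 i2 i3 : 'I_k) :
    val i1 = 0%N -> val i2 = 1%N -> val i3 = 2%N ->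
    (forall i j : 'I_k, (i <= j)%N -> (a j <= a i)%N) ->
  (\sum_(i < k) a i <= a i1 + a i2 + (k - 2) * a i3)%N.
Proof.
move=> v1 v2 v3 mono.
have ne12 : i1 != i2 by rewrite -val_eqE /= v1 v2.
rewrite (bigD1 i1) //= (bigD1 i2) /=; last by rewrite eq_sym.
rewrite addnA leq_add2l.
apply: (@leq_trans (\sum_(i < k | (i != i1) && (i != i2)) a i3)).
  apply: leq_sum => i; rewrite -!val_eqE /= v1 v2 => /andP[gt0 gt1].
  by apply: mono; rewrite v3; case: (nat_of_ord i) gt0 gt1 => [|[|]].
rewrite sum_nat_const leq_mul2r; apply/orP; right.
have := cardC [set i1; i2]; rewrite cards2 ne12 card_ord /=.
move/(canRL (addKn 2)) => <-; apply: subset_leq_card.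
by apply/subsetP => i; rewrite !inE negb_or.
Qed.

(** In the application [A] and [B] are the neighbourhoods of two tuples, and
    [between P i1 i2 A B] consists of the absorbers of this pair. *)
Lemma few_between_parity (P : {set tup}) (a : 'I_k -> nat) (eps gam : R)
    (i1 i2 : 'I_k) (A B : {set 'I_n}) :
    (3 <= k)%N -> (0 < n)%N ->
    (forall i f, (a i <= #|nbr P i f|)%N) ->
    val i1 = 0%N -> val i2 = 1%N ->
    (forall i j : 'I_k, (i <= j)%N -> (a j <= a i)%N) ->
    0 < eps <= 2^-1 -> 0 < gam <= eps ->
    eps * n%:R <= (a i2)%:R ->
    (1 - gam / 5) * n%:R <= (\sum_(i < k) a i)%N%:R ->
    (a i1 <= #|A|)%N -> (a i2 <= #|B|)%N ->
    #|between P i1 i2 A B|%:R < eps ^+ 3 * (n ^ k)%:R ->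
  parity_structure P a ((2 * k ^ 2)%N%:R * eps) i1 i2 A B.
Proof.
move=> k3 n0 deg v1 v2 mono /andP[e0 e1] /andP[g0 g1] a2e suma aA aB few.
pose i3 := Ordinal k3; have v3 : val i3 = 2%N by [].
have ne12 : i1 != i2 by rewrite -val_eqE /= v1 v2.
have ne21 : i2 != i1 by rewrite eq_sym.
have ne13 : i1 != i3 by rewrite -val_eqE /= v1.
have ne23 : i2 != i3 by rewrite -val_eqE /= v2.
have nR : 0 < n%:R :> R by rewrite ltr0n.
have KR : 0 < (n ^ k)%:R :> R by rewrite ltr0n expn_gt0 n0.
have kR : 3 <= k%:R :> R by rewrite ler_nat.
pose s : R := gam / 5 + (k%:R - 2) * eps.
have k2e : eps <= (k%:R - 2) * eps.
  by rewrite -[X in X <= _]mul1r ler_wpM2r ?(ltW e0) //; move: kR; clear; lra.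
have s0 : 0 <= s by move: g0 e0 k2e; rewrite /s; clear; lra.
have sum3 : (a i3)%:R < eps * n%:R -> (1 - s) * n%:R <= (a i1)%:R + (a i2)%:R :> R.
  move=> a3e; have := sum_codeg_le v1 v2 v3 mono.
  rewrite -(ler_nat R) !natrD natrM natrB ?(leq_trans _ k3) // => H.
  have : (k%:R - 2) * (a i3)%:R <= (k%:R - 2) * (eps * n%:R).
    by apply: ler_wpM2l; [move: kR; clear; lra | exact: ltW].
  by move: H suma; rewrite /s; clear; lra.
have le_n (D : {set 'I_n}) : #|D|%:R <= n%:R :> R.
  by rewrite ler_nat (leq_trans (max_card _)) ?card_ord.
pose Y := [set e : tup | (e \notin P) && ((e i1 \in A) (+) (e i2 \in B))].
pose Y1 := [set e : tup | [&& e \notin P, e i1 \in A & e i2 \notin B]].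
pose Y2 := [set e : tup | [&& e \notin P, e i2 \in B & e i1 \notin A]].
have [||||||||a3e pa qa YK] :=
    @parity_arith eps n%:R (n ^ k)%:R (a i1)%:R (a i2)%:R (a i3)%:R #|A|%:R
      #|B|%:R #|between P i1 i2 A B|%:R #|Y1|%:R #|Y2|%:R s
      e0 e1 nR KR s0 _ a2e _ _ (le_n A) (le_n B) sum3 few.
- by rewrite ler_nat mono // v1.
- by rewrite ler_nat.
- by rewrite ler_nat.
- by rewrite -natrX -!natrM ler_nat; exact: (between_dense3 deg A B ne12 ne13 ne23).
- rewrite -natrX -!(natrM, natrD) ler_nat.
  exact: (between_dense2 deg A B ne12).
- rewrite betweenC -natrX -!(natrM, natrD) ler_nat.
  exact: (between_dense2 deg B A ne21).
- rewrite -natrX -!(natrM, natrD) ler_nat.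
  exact: (nonedges_across deg A B ne12).
- rewrite betweenC -natrX -!(natrM, natrD) ler_nat.
  exact: (nonedges_across deg B A ne21).
set th : R := _ * eps.
(* The total loss is at most [(3 * k - 3) * eps], well below
   [2 * k ^ 2 * eps]. *)
have e3 : eps ^+ 3 <= eps / 4.
  rewrite exprS ler_wpM2l ?(ltW e0) //.
  have -> : 4^-1 = 2^-1 ^+ 2 :> R by rewrite exprVn -natrX.
  by rewrite lerXn2r ?nnegrE ?invr_ge0 ?ler0n ?(ltW e0).
have k2 : 3 * k%:R * eps <= k%:R ^+ 2 * eps.
  by rewrite ler_wpM2r ?(ltW e0) // expr2 ler_wpM2r.
have th_ge : eps + 3 * s + 2 * eps ^+ 3 <= th.
  rewrite /th /s natrM natrX; move: e3 k2 g1 kR e0; clear; nra.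
have cY : #|Y|%:R <= #|Y1|%:R + #|Y2|%:R :> R.
  rewrite -natrD ler_nat -cardsUI; apply: leq_trans (leq_addr _ _).
  apply: subset_leq_card; apply/subsetP => e; rewrite !inE.
  by case: (e \in P) (e i1 \in A) (e i2 \in B) => [] [] [].
have e30 : 0 < eps ^+ 3 by rewrite exprn_gt0.
have thK : (eps + 3 * s + 2 * eps ^+ 3) * (n ^ k)%:R <= th * (n ^ k)%:R.
  by apply: ler_wpM2r; rewrite // ltW.
have sN : 0 <= s * n%:R by rewrite mulr_ge0 // ltW.
have eN : 0 <= eps * n%:R by rewrite mulr_ge0 // ltW.
have esN : eps * n%:R <= s * n%:R.
  by rewrite ler_wpM2r ?(ltW nR) //; move: g0 k2e; rewrite /s; clear; lra.
have thN : (eps + 3 * s) * n%:R <= th * n%:R.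
  by apply: ler_wpM2r; [exact: ltW | move: th_ge e30; clear; lra].
have sumN := sum3 a3e.
have a12 : (a i2)%:R <= (a i1)%:R :> R by rewrite ler_nat mono // v1.
move: aA aB; rewrite -!(ler_nat R) => aA aB.
split.
- by move: pa qa sN eN esN thN sumN a12 aA aB; clear; lra.
- by move: pa qa sN eN esN thN sumN a12 aA aB; clear; lra.
- move=> i i_ge2; apply: (@le_trans _ _ (a i3)%:R); first by rewrite ler_nat mono.
  by move: a3e sN thN; clear; lra.
- by rewrite -natrX; move: cY YK thK; clear; lra.
Qed.
End Parity.

(** * From k-partite graphs to sets of tuples *)
Section Coding.
Variables (k n : nat) (T : finType) (V : 'I_k -> {set T}) (E : {set {set T}}).
Hypotheses (pV : kpartite V E) (cV : forall i, #|V i| = n).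
Local Notation tup := {ffun 'I_k -> 'I_n}.
Implicit Types (f g : tup) (i j : 'I_k) (x : 'I_n).

Definition vtx i x : T := enum_val (cast_ord (esym (cV i)) x).

Lemma vtx_in i x : vtx i x \in V i.
Proof. exact: enum_valP. Qed.

Lemma vtx_inj i : injective (vtx i).
Proof. by move=> x y /enum_val_inj/cast_ord_inj. Qed.

Lemma vtx_onto i v : v \in V i -> exists x, vtx i x = v.
Proof.
move=> vi; exists (cast_ord (cV i) (enum_rank_in vi v)).
by rewrite /vtx cast_ordK enum_rankK_in.
Qed.

Lemma part_eq i j v : v \in V i -> v \in V j -> i = j.
Proof.
have [_ dV _] := pV; move=> vi vj; apply/eqP; apply: contraT => ij.
by have := disjointFr (dV _ _ ij) vi; rewrite vj.
Qed.

Lemma part_ex v : exists i, v \in V i.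
Proof.
have [cover _ _] := pV; have : v \in [set: T] by rewrite inE.
by rewrite -cover => /bigcupP[i _]; exists i.
Qed.

Lemma vtx_eq i j x y : vtx i x = vtx j y -> i = j /\ x = y.
Proof.
move=> e; have ij : i = j.
  by apply: (part_eq (vtx_in i x)); rewrite e vtx_in.
by split=> //; rewrite -ij in e; apply: vtx_inj e.
Qed.

Definition edge_of f : {set T} := [set vtx i (f i) | i : 'I_k].
Definition codes : {set tup} := [set f | edge_of f \in E].

Lemma mem_edge_of f i x : (vtx i x \in edge_of f) = (x == f i).
Proof.
apply/imsetP/eqP => [[j _ /vtx_eq[-> ->]]|->] //; by exists i.
Qed.

Lemma edge_of_inj : injective edge_of.
Proof.
move=> f g e; apply/ffunP => i; apply/eqP.
by rewrite -mem_edge_of -e mem_edge_of.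
Qed.

Lemma edge_ofP (S : {set T}) : (forall i, #|S :&: V i| = 1) -> exists f, S = edge_of f.
Proof.
move=> S1.
have ex i : exists x, S :&: V i == [set vtx i x].
  have /eqP/cards1P[v Sv] := S1 i.
  have vi : v \in V i by have := set11 v; rewrite -Sv inE => /andP[].
  by have [x xv] := vtx_onto vi; exists x; rewrite Sv xv.
exists [ffun i => xchoose (ex i)]; apply/setP => v.
have [i vi] := part_ex v; have [x xv] := vtx_onto vi.
rewrite -xv mem_edge_of ffunE; have /eqP/setP/(_ v) := xchooseP (ex i).
by rewrite !inE vi andbT -xv (inj_eq (@vtx_inj i)).
Qed.

Lemma codes_onto e : e \in E -> exists2 f, f \in codes & e = edge_of f.
Proof.
move=> eE; have [_ _ e1] := pV; have [f ef] := edge_ofP (e1 e eE).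
by exists f; rewrite // inE -ef.
Qed.

(** Removing the [i]-th vertex of [edge_of f] gives a transversal that misses part
    [i], and its neighbours all lie in that part. *)
Lemma codeg_le_nbr i f : min_codeg V E i <= #|nbr codes i f|.
Proof.
pose S := [set vtx j (f j) | j in [set~ i]].
have vtxS j x : (vtx j x \in S) = (j != i) && (x == f j).
  apply/imsetP/andP => [[m + /vtx_eq[-> ->]]|[ji /eqP->]].
    by rewrite !inE.
  by exists j; rewrite ?inE.
have upS x : vtx i x |: S = edge_of (upd f i x).
  apply/setP => v; have [j vj] := part_ex v; have [y <-] := vtx_onto vj.
  rewrite in_setU1 vtxS mem_edge_of; have [->|ji] := eqVneq j i.
    by rewrite orbF upd_same (inj_eq (@vtx_inj i)).
  rewrite upd_other //; case: eqP => // /vtx_eq[e _].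
  by case/eqP: ji.
have Str : S \in transversals_off V i.
  rewrite inE; apply/andP; split.
    rewrite card_imset ?cardsC1 ?card_ord // => j m /vtx_eq[] //.
  apply/forall_inP => j ji; apply/cards1P; exists (vtx j (f j)).
  apply/setP => v; rewrite !inE; apply/andP/eqP => [[vS vj]|->].
    by have [y yv] := vtx_onto vj; move: vS; rewrite -yv vtxS => /andP[_ /eqP->].
  by rewrite vtxS ji eqxx vtx_in.
apply: (@leq_trans (deg E S)).
  rewrite /min_codeg; elim: (index_enum _) (mem_index_enum S) => // A s IH.
  rewrite inE big_cons => /predU1P[<-|/IH le]; first by rewrite Str geq_minl.
  by case: ifP => // _; rewrite geq_min le orbT.
rewrite -(card_imset _ (@vtx_inj i)); apply: subset_leq_card.
apply/subsetP => v; rewrite inE => vE.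
have [_ _ e1] := pV; have [j vj] := part_ex v; have [x xv] := vtx_onto vj.
suff ji : j = i by apply/imsetP; exists x; rewrite ?inE -?upS -ji xv.
have /eqP/cards1P[w we] := e1 _ vE i.
have : w \in (v |: S) :&: V i by rewrite we set11.
rewrite in_setI in_setU1 => /andP[/orP[/eqP->|wS] wi]; first exact: part_eq vj wi.
by have [y yw] := vtx_onto wi; move: wS; rewrite -yw vtxS eqxx.
Qed.

Lemma matching_of (M : {set tup}) : tmatching codes M ->
  matching E (edge_of @: M) /\ #|edge_of @: M| = #|M|.
Proof.
move=> /tmatchingP[sP dM]; split; last by rewrite card_imset //; apply: edge_of_inj.
split; first by apply/subsetP => e /imsetP[f /sP fP ->]; rewrite inE in fP.
apply/trivIsetP => _ _ /imsetP[f fM ->] /imsetP[g gM ->] ne.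
rewrite -setI_eq0; apply/eqP/setP => v; rewrite in_setI in_set0.
have [j vj] := part_ex v; have [y <-] := vtx_onto vj; rewrite !mem_edge_of.
apply/andP => -[/eqP yf /eqP yg]; have fg : f != g by apply: contra_neq ne => ->.
by apply: (disjP _ _ (dM f g fM gM fg) j); rewrite -yf.
Qed.

Definition vset (C : 'I_k -> {set 'I_n}) : {set T} :=
  \bigcup_j [set vtx j x | x in C j].

Lemma mem_vset (C : 'I_k -> {set 'I_n}) i x :
  (vtx i x \in vset C) = (x \in C i).
Proof.
apply/bigcupP/idP => [[j _ /imsetP[y yC /vtx_eq[-> ->]]]|xC] //.
by exists i => //; apply: imset_f.
Qed.

Lemma card_vset_part (C : 'I_k -> {set 'I_n}) i : #|vset C :&: V i| = #|C i|.
Proof.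
rewrite -(card_imset _ (@vtx_inj i)); apply: eq_card => v; rewrite in_setI.
apply/andP/imsetP => [[vC vi]|[x xC ->]].
  by have [x xv] := vtx_onto vi; exists x; rewrite // -mem_vset xv.
by rewrite mem_vset vtx_in.
Qed.

Lemma independent_of (C : 'I_k -> {set 'I_n}) :
    (forall f, f \in codes -> (forall i, f i \in C i) -> False) ->
  independent E (vset C).
Proof.
move=> indC e eE; apply/negP => /subsetP eC; have [f fP ef] := codes_onto eE.
apply: (indC f fP) => i; rewrite -mem_vset; apply: eC.
by rewrite ef mem_edge_of.
Qed.

Lemma crossing_code (S : {set T}) :
  #|S| = k -> crossing V S -> exists f, S = edge_of f.
Proof.
move=> cS /forallP S1; apply: edge_ofP => i; apply/eqP.
rewrite eqn_leq S1 /= lt0n; apply: contraT => /negPn/eqP Si.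
have : #|S| <= \sum_j #|S :&: V j|.
  apply: (@leq_trans #|\bigcup_j (S :&: V j)|).
    apply: subset_leq_card; apply/subsetP => v vS.
    by have [j vj] := part_ex v; apply/bigcupP; exists j; rewrite // inE vS.
  elim/big_rec2: _ => [|j m U _ le_m]; first by rewrite cards0.
  by apply: leq_trans (leq_card_setU _ _) _; rewrite leq_add2l.
rewrite (bigD1 i) //= Si add0n cS leqNgt => /negP[].
apply: (@leq_ltn_trans (\sum_(j < k | j != i) 1)); first exact: leq_sum.
rewrite sum1_card (_ : #|_| = #|[set~ i]|); last first.
  by apply: eq_card => j; rewrite !inE.
by rewrite cardsC1 card_ord ltn_predL (leq_trans _ (ltn_ord i)).
Qed.

(** The set A of a D-extremal partition need only meet the first two parts: the
    parity of an intersection is then decided there. *)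
Definition two_parts (i1 i2 : 'I_k) (A B : {set 'I_n}) i : {set 'I_n} :=
  if i == i1 then A else if i == i2 then B else set0.

Lemma E_odd_missing (i1 i2 : 'I_k) (A B : {set 'I_n}) : i1 != i2 ->
  #|E_odd V (vset (two_parts i1 i2 A B)) :\: E| <=
  #|[set f : tup | (f \notin codes) && ((f i1 \in A) (+) (f i2 \in B))]|.
Proof.
move=> ne; rewrite -(card_imset _ edge_of_inj); apply: subset_leq_card.
set Z := vset _.
have memZ i x :
    (vtx i x \in Z) = (i == i1) && (x \in A) || (i == i2) && (x \in B).
  rewrite mem_vset /two_parts; have [->|_] := eqVneq i i1.
    by rewrite (negPf ne) orbF.
  by case: (i == i2); rewrite ?inE.
apply/subsetP => S /setDP[]; rewrite inE => /and3P[/eqP cS crS oddS] SE.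
have [f Sf] := crossing_code cS crS; rewrite Sf in oddS SE *.
apply: imset_f; rewrite inE inE SE /=; apply: contraTT oddS => par.
have [fA|fA] := boolP (f i1 \in A); have [fB|fB] := boolP (f i2 \in B);
  rewrite ?fA ?fB ?(negPf fA) ?(negPf fB) // in par.
  have -> : edge_of f :&: Z = [set vtx i1 (f i1); vtx i2 (f i2)].
    apply/setP => v; rewrite in_setI in_set2.
    apply/andP/orP => [[/imsetP[j _ ->]]|[]/eqP->].
    - by rewrite memZ => /orP[]/andP[/eqP-> _]; [left | right].
    - by rewrite mem_edge_of memZ !eqxx fA.
    - by rewrite mem_edge_of memZ !eqxx fB orbT.
  by rewrite cards2; case: eqP => // /vtx_eq[/eqP]; rewrite (negPf ne).
suff -> : edge_of f :&: Z = set0 by rewrite cards0.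
apply/setP => v; rewrite in_setI in_set0; apply/andP => -[/imsetP[j _ ->]].
by rewrite memZ => /orP[]/andP[/eqP->]; apply/negP.
Qed.

End Coding.

(** * Logarithms are sublinear *)
Lemma linear_le_exp2 C L : 4 * C <= L -> C * L.+1 <= 2 ^ L.
Proof.
move=> le4; pose h := L./2.
have hL : L = odd L + h.*2 by rewrite /h odd_double_half.
have h2 : h < 2 ^ h by apply: ltn_expl.
have Ch : C.*2 <= h by rewrite /h; lia.
have -> : 2 ^ L = 2 ^ odd L * (2 ^ h * 2 ^ h).
  by rewrite {1}hL expnD -addnn expnD.
have L1 : L.+1 <= (h.+1).*2 by rewrite /h; lia.
have : C * L.+1 <= C.*2 * h.+1 by nia.
have : C.*2 * h.+1 <= 2 ^ h * 2 ^ h by rewrite leq_mul // (leq_trans Ch) // ltnW.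
have : 0 < 2 ^ odd L by rewrite expn_gt0.
nia.
Qed.

Local Open Scope ring_scope.

Lemma bernoulli (R : realFieldType) (x : R) p : 0 <= x -> 1 + p%:R * x <= (1 + x) ^+ p.
Proof.
move=> x0; elim: p => [|p IH]; first by rewrite mul0r addr0 expr0.
have p0 : 0 <= p%:R * x ^+ 2 by rewrite mulr_ge0 ?exprn_ge0.
have : (1 + x) * (1 + p%:R * x) <= (1 + x) ^+ p.+1.
  by rewrite exprS ler_wpM2l // addr_ge0.
by rewrite -[p.+1]addn1 natrD; move: p0; clear; lra.
Qed.

Lemma expr_le_half (R : archiRealFieldType) (q : R) :
  0 <= q -> q < 1 -> exists p, q ^+ p <= 2^-1.
Proof.
move=> q0 q1; have d0 : 0 < 1 - q by rewrite subr_gt0.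
pose p := Num.bound (1 - q)^-1; exists p.
have pd : 1 <= p%:R * (1 - q).
  rewrite -ler_pdivrMr // div1r; apply: ltW.
  by apply: archi_boundP; rewrite invr_ge0 ltW.
have qd : q ^+ p * (1 + (1 - q)) ^+ p <= 1.
  rewrite -exprMn exprn_ile1 //; first by move: q0 q1; clear; nra.
  by move: q0 q1; clear; nra.
have := bernoulli p (ltW d0); have qp : 0 <= q ^+ p by rewrite exprn_ge0.
move=> /(ler_wpM2l qp) H; rewrite -(@ler_pM2r _ 2) // mulVf ?pnatr_eq0 //.
apply: le_trans qd; apply: le_trans H; apply: ler_wpM2l => //.
by move: pd; clear; lra.
Qed.

(** With [q ^+ p <= 2^-1], taking [N = p * d * (log n + 1)] beats [n ^ d], and
    such an [N] is at most [n / B] for large [n]. *)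
Lemma sublinear_decay (R : archiRealFieldType) (q : R) (d B : nat) :
    0 <= q -> q < 1 -> (0 < d)%N ->
  exists n0, forall n, (n0 <= n)%N ->
    exists2 N, (B * N <= n)%N & (n ^ d)%N%:R * q ^+ N < 1.
Proof.
move=> q0 q1 d0; have [p qp] := expr_le_half q0 q1.
pose C := (B * (p * d))%N; exists (2 ^ (4 * C))%N => n le_n.
have n_gt0 : (0 < n)%N by apply: leq_trans le_n; rewrite expn_gt0.
pose L := trunc_log 2 n; exists (p * d * L.+1)%N.
  rewrite mulnA -/C; apply: leq_trans (@trunc_logP 2 n isT n_gt0).
  by apply: linear_le_exp2; apply: trunc_log_max.
have n_lt : (n < 2 ^ L.+1)%N by apply: trunc_log_ltn.
have : q ^+ (p * d * L.+1) <= (2^-1 : R) ^+ (L.+1 * d).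
  rewrite -mulnA exprM [(d * _)%N]mulnC lerXn2r ?nnegrE ?exprn_ge0 //.
  by rewrite invr_ge0.
rewrite exprVn => H; apply: (@le_lt_trans _ _ ((n ^ d)%:R / 2 ^+ (L.+1 * d))).
  by apply: ler_wpM2l.
rewrite ltr_pdivrMr ?exprn_gt0 // mul1r -natrX ltr_nat expnM.
by rewrite ltn_exp2r.
Qed.

(** * The three cases *)

(** The constants are chosen in the order [c], [t], [K], [B]: a pair has a
    proportion [c] of all tuples as absorbers, [k * t] uncovered vertices per part
    suffice for the space barrier, so [K = k * t] absorbers per pair are needed,
    and [B] makes the absorbing matching negligible against both [c * n] and
    [gam * n]. *)
Lemma tuple_dichotomy (R : archiRealFieldType) (k : nat) (eps gam : R) :
    (3 <= k)%N -> 0 < eps <= 2^-1 -> 0 < gam <= eps ->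
  exists n0, forall n, (n0 <= n)%N ->
  forall (P : {set {ffun 'I_k -> 'I_n}}) (a : 'I_k -> nat) (i1 i2 : 'I_k),
    val i1 = 0%N -> val i2 = 1%N ->
    (forall i f, (a i <= #|nbr P i f|)%N) ->
    (forall i j : 'I_k, (i <= j)%N -> (a j <= a i)%N) ->
    eps * n%:R <= (a i2)%:R ->
    (1 - gam / 5) * n%:R <= (\sum_(i < k) a i)%N%:R ->
  [\/ exists M, tmatching P M /\ (n - 1 <= #|M|)%N,
      (\sum_(i < k) a i)%N%:R <= (1 + gam) * n%:R
      /\ exists C : 'I_k -> {set 'I_n},
           (forall f : {ffun 'I_k -> 'I_n},
              f \in P -> (forall i, f i \in C i) -> False)
           /\ forall i, n%:R - (a i)%:R - gam * n%:R <= #|C i|%:R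
    | exists A B, parity_structure P a ((2 * k ^ 2)%N%:R * eps) i1 i2 A B].
Proof.
move=> k3 /andP[e0 e1] /andP[g0 g1].
have k_gt0 : (0 < k)%N by apply: leq_trans k3.
have kR : 0 < k%:R :> R by rewrite ltr0n.
pose c : R := eps ^+ 3; have c0 : 0 < c by rewrite exprn_gt0.
have c1 : c <= 1.
  by apply: exprn_ile1; [exact: ltW | apply: le_trans e1 _; clear; lra].
pose t := Num.bound (4 * k%:R ^+ 2 / gam).
have t_ge : 4 * k%:R ^+ 2 <= t%:R * gam.
  rewrite -ler_pdivrMr //; apply: ltW; apply: archi_boundP.
  by rewrite divr_ge0 ?mulr_ge0 ?exprn_ge0 // ltW.
have tR : 0 < t%:R :> R.
  by rewrite -(pmulr_lgt0 _ g0); apply: lt_le_trans t_ge; rewrite mulr_gt0 ?exprn_gt0.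
pose K := (k * t)%N.
pose B := maxn (Num.bound ((K * k)%:R / (c / 2))) (Num.bound ((4 * k * K)%:R / gam)).
have B1 : (K * k)%:R <= c / 2 * B%:R.
  rewrite mulrC -ler_pdivrMr ?divr_gt0 //.
  apply: (@le_trans _ _ (Num.bound ((K * k)%:R / (c / 2)))%:R).
    by apply: ltW; apply: archi_boundP; rewrite divr_ge0 // divr_ge0 // ltW.
  by rewrite ler_nat leq_maxl.
have B2 : (4 * k * K)%:R <= gam * B%:R.
  rewrite mulrC -ler_pdivrMr //.
  apply: (@le_trans _ _ (Num.bound ((4 * k * K)%:R / gam))%:R).
    by apply: ltW; apply: archi_boundP; rewrite divr_ge0 // ltW.
  by rewrite ler_nat leq_maxr.
have [|||n0 decay] := @sublinear_decay R (1 - c / 2) (k + k) B.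
- by move: c1; clear; lra.
- by move: c0; clear; lra.
- by rewrite addn_gt0 k_gt0.
exists n0.+1 => n lt_n P a i1 i2 v1 v2 deg mono a2e suma.
have n_gt0 : (0 < n)%N by apply: leq_ltn_trans lt_n.
have nR : 0 < n%:R :> R by rewrite ltr0n.
pose X (j : {ffun 'I_k -> 'I_n} * {ffun 'I_k -> 'I_n}) :=
  between P i1 i2 (nbr P i1 j.1) (nbr P i2 j.2).
have [/existsP[j few]|] := boolP [exists j, #|X j|%:R < c * (n ^ k)%:R].
  apply: Or33; exists (nbr P i1 j.1), (nbr P i2 j.2).
  by apply: (@few_between_parity R k n P a eps gam) => //; apply/andP.
rewrite negb_exists => /forallP many.
have X_large j : c * (n ^ k)%:R <= #|X j|%:R by rewrite leNgt.
have [N BN decayN] := decay n (ltnW lt_n).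
have BNR : B%:R * N%:R <= n%:R :> R by rewrite -natrM ler_nat.
have N0 : 0 <= N%:R :> R by [].
have [j||| M0 [mM0 cM0 hit0]] :=
  @absorbing_family R k n k_gt0 n_gt0 P _ X c c0 c1 _ X_large K N.
- by apply/subsetP => e; rewrite inE => /andP[].
- rewrite mulnAC natrM; apply: le_trans (ler_wpM2r N0 B1) _.
  by rewrite -[_ * N%:R]mulrA ler_wpM2l // divr_ge0 // ltW.
- by rewrite card_prod card_ffun !card_ord -expnD.
have [M [mM sM]] := near_perfect_or_space t k_gt0 deg mM0.
case=> [lt|[m [C [sum_m m_ge cC indC]]]].
  apply: Or31; apply: (absorb k_gt0 (i := i1) (j := i2) (w := K) _ mM).
  - by rewrite -val_eqE /= v1 v2.
  - exact: ltnW.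
  - move=> f g; apply: leqW; apply: leq_trans (hit0 (f, g)) _.
    by apply: subset_leq_card; apply: setSI.
apply: Or32.
(* The size of [M0] and the error [k * n / t] each cost half of [r]. *)
pose r : R := gam * n%:R / (2 * k%:R).
have rk : k%:R * r = gam * n%:R / 2 by rewrite /r; field; exact: lt0r_neq0.
have M0R : #|M0|%:R <= r / 2.
  have : #|M0|%:R <= K%:R * N%:R :> R by rewrite -natrM ler_nat.
  have : 4 * k%:R * (K%:R * N%:R) <= gam * n%:R.
    have -> : 4 * k%:R * (K%:R * N%:R) = (4 * k * K)%:R * N%:R :> R.
      by rewrite [in RHS]natrM [in RHS]natrM mulrA.
    apply: le_trans (ler_wpM2r N0 B2) _.
    by rewrite -[_ * N%:R]mulrA ler_wpM2l // ltW.
  rewrite (_ : r / 2 = gam * n%:R / (4 * k%:R)); last first.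
    by rewrite /r; field; exact: lt0r_neq0.
  rewrite mulrC -ler_pdivlMr ?mulr_gt0 //; exact: (fun x y => le_trans y x).
have am i : (a i)%:R <= (m i)%:R + r.
  have := m_ge i; rewrite -(ler_nat R) natrD !natrM natrD => H.
  have kn : k%:R * n%:R <= t%:R * (r / 2).
    rewrite (_ : t%:R * (r / 2) = t%:R * gam * (n%:R / (4 * k%:R))); last first.
      by rewrite /r; field; exact: lt0r_neq0.
    apply: (@le_trans _ _ (4 * k%:R ^+ 2 * (n%:R / (4 * k%:R)))).
      by rewrite le_eqVlt; apply/orP; left; apply/eqP; field; exact: lt0r_neq0.
    by apply: ler_wpM2r t_ge; rewrite divr_ge0 // mulr_ge0 // ltW.
  rewrite -(ler_pM2l tR); have := ler_wpM2l (ltW tR) M0R.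
  by move: H kn; rewrite !mulrDr; clear; lra.
have r0 : 0 <= r by rewrite /r divr_ge0 ?mulr_ge0 // ltW.
have gn : 0 <= gam * n%:R by rewrite mulr_ge0 // ltW.
split.
  have : (\sum_(i < k) a i)%N%:R <= (\sum_(i < k) m i)%N%:R + k%:R * r.
    rewrite !natr_sum mulr_natl -[X in r *+ X]card_ord -sumr_const -big_split.
    by apply: ler_sum.
  move: sum_m; rewrite -(ler_nat R) rk; move: gn; clear; lra.
exists C; split=> // i.
have suma' : (\sum_(i < k) a i)%N%:R <= (a i)%:R + #|C i|%:R + k%:R * r.
  have -> : #|C i| = (\sum_(j < k | j != i) m j)%N.
    by apply/eqP; rewrite -(eqn_add2r (m i)) cC (bigD1 i) //= addnC.
  rewrite (bigD1 i) //= natrD -addrA lerD2l !natr_sum.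
  apply: (@le_trans _ _ (\sum_(j < k | j != i) ((m j)%:R + r))); first exact: ler_sum.
  rewrite big_split lerD2l sumr_const -[_ *+ _]mulr_natl ler_wpM2r // ler_nat.
  by rewrite (leq_trans (max_card _)) ?card_ord.
by move: suma suma' gn; rewrite rk; clear; lra.
Qed.

Theorem theorem1p4 (R : realType) (k : nat) (hk : (3 <= k)%N) :
  exists2 eps1 : R, 0 < eps1 & forall eps : R, 0 < eps <= eps1 ->
  exists2 gam1 : R, 0 < gam1 & forall gam : R, 0 < gam <= gam1 ->
  exists n0 : nat, forall n : nat, (n0 <= n)%N ->
  forall (T : finType) (V : 'I_k -> {set T}) (E : {set {set T}}),
    kgraph k E ->
    kpartite V E ->
    (forall i : 'I_k, #|V i| = n) ->
    (forall i : 'I_k, i = 0%N :> nat ->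
       (min_codeg V E i)%:R <= (1 - eps) * n%:R) ->
    (forall i j : 'I_k, (i <= j)%N -> (min_codeg V E j <= min_codeg V E i)%N) ->
    (forall i : 'I_k, i = 1%N :> nat -> eps * n%:R <= (min_codeg V E i)%:R) ->
    (1 - gam / 5) * n%:R <= (\sum_(i < k) min_codeg V E i)%N%:R ->
    [\/ exists M : {set {set T}}, matching E M /\ (n - 1 <= #|M|)%N,
        S_extremal V E n gam
      | D_extremal V E n ((2 * k ^ 2)%N%:R * eps)].
Proof.
have half_gt0 : 0 < 2^-1 :> R by rewrite invr_gt0.
exists 2^-1 => // eps epsP; have [eps_gt0 _] := andP epsP.
exists eps => // gam gamP.
have [n0 dichotomy] := @tuple_dichotomy R k eps gam hk epsP gamP.
exists n0 => n le_n T V E _ pV cV _ mono a2_ge sum_ge.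
have k_gt0 : (0 < k)%N by apply: leq_trans hk.
pose i1 : 'I_k := Ordinal k_gt0; pose i2 : 'I_k := Ordinal (ltnW hk).
have ne12 : i1 != i2 by [].
have [||||||[M [mM cM]]|[sum_le [C [indC cC]]]|[A [B [[a1P a2P] [AP BP] aP missing]]]] :=
  dichotomy n le_n (codes E cV) (min_codeg V E) i1 i2.
- by [].
- by [].
- exact: codeg_le_nbr.
- exact: mono.
- exact: a2_ge.
- exact: sum_ge.
- have [mE cE] := matching_of pV mM.
  by apply: Or31; exists (edge_of cV @: M); rewrite cE.
- apply: Or32; split=> //; exists (vset cV C).
  split; first exact: independent_of.
  by move=> i; rewrite (card_vset_part pV).
- apply: Or33; pose Z := vset cV (two_parts i1 i2 A B).
  exists Z, (~: Z); split=> //.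
  + exact: setUCr.
  + by rewrite -setI_eq0 setICr.
  + move=> i i_lt2; rewrite (card_vset_part pV) /two_parts.
    have [->|i_ne1] := eqVneq i i1; first by [].
    have -> : i = i2.
      apply: val_inj; move: i_lt2 i_ne1; rewrite -val_eqE /=.
      by case: (nat_of_ord i) => [|[|]].
    by rewrite eqxx.
  + right; apply: le_trans missing; rewrite ler_nat.
    exact: E_odd_missing.
Qed.
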